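(* Let $n \ge 1$ and let $f_i(x) = a_i x + b_i$, for $i = 1, \ldots, n$, be affine maps $\mathbb{R}\to\mathbb{R}$ with real coefficients such that $a_i > 1$ for all $i$. Put $s_i = \frac{b_i}{1-a_i}$. Suppose that, after a suitable relabelling (permutation) of the maps $f_1,\ldots,f_n$, one has $$s_1 < s_2 < \cdots < s_n$$ and $$\frac{s_n - b_i}{a_i} \le \frac{s_1 - b_{i+1}}{a_{i+1}} \quad \text{for all } i = 1, \ldots, n-1.$$ Then the semigroup $S = \langle f_1, \ldots, f_n\rangle$ (under composition) is free of rank $n$ with free basis $f_1, \ldots, f_n$.
   Context: For affine maps $f_1,\dots,f_r$ of $\mathbb{R}$, $\langle f_1,\dots,f_r\rangle$ denotes the semigroup they generate under composition $\circ$. It is called free of rank $r$ with free basis $f_1,\dots,f_r$ if there are no two distinct finite nonempty sequences of indices $(i_1,\dots,i_k)$ and $(j_1,\dots,j_l)$ in $\{1,\dots,r\}$ with $f_{i_1}\circ\cdots\circ f_{i_k} = f_{j_1}\circ\cdots\circ f_{j_l}$. *)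

(* Defs.v *)
From mathcomp Require Import all_boot all_order all_algebra all_fingroup.
From mathcomp Require Import reals.
Set Implicit Arguments.
Unset Strict Implicit.
Unset Printing Implicit Defensive.
Import Order.TTheory GRing.Theory Num.Theory.
Local Open Scope ring_scope.

Definition affine (R : realType) (a b : R) : R -> R := fun x => a * x + b.

(* The point b / (1 - a) fixed by x |-> a x + b when a <> 1. *)
Definition affine_fix (R : realType) (a b : R) : R := b / (1 - a).

(* word_comp f [:: i1; ...; ik] is f i1 \o ... \o f ik: the last letter acts
   first. *)
Definition word_comp (T : Type) (r : nat) (f : 'I_r -> T -> T) (w : seq 'I_r) :
    T -> T :=
  foldr (fun i g => f i \o g) id w.

(* The elements of the semigroup generated by f are the maps word_comp f w with
   w nonempty; it is free of rank r with free basis f when no two distinct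
   nonempty words give the same map. *)
Definition free_semigroup_basis (T : Type) (r : nat) (f : 'I_r -> T -> T) : Prop :=
  forall u v : seq 'I_r, u <> [::] -> v <> [::] ->
    word_comp f u =1 word_comp f v -> u = v.

(* The condition on maps that are already labelled in the required order; the
   number of maps is m.+1, the first index is ord0 and the last is ord_max. *)
Definition suitably_labelled (R : realType) (m : nat) (a b : 'I_m.+1 -> R) : Prop :=
  let s i := affine_fix (a i) (b i) in
  (forall i j : 'I_m.+1, (i < j)%N -> s i < s j) /\
  (forall i j : 'I_m.+1, nat_of_ord j = (nat_of_ord i).+1 ->
     (s ord_max - b i) / a i <= (s ord0 - b j) / a j).

(* Main.v *)
Require Import Defs.
From mathcomp Require Import all_boot all_order all_algebra all_fingroup.
From mathcomp Require Import reals.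
From mathcomp Require Import lra.
Set Implicit Arguments.
Unset Strict Implicit.
Unset Printing Implicit Defensive.
Import Order.TTheory GRing.Theory Num.Theory.
Local Open Scope ring_scope.

(** The inverses g_i of the maps f_i are contractions fixing s_i, so they map
    the open interval U = ]s_1, s_n[ into itself, and the second hypothesis says
    that the images g_i(U) are pairwise disjoint.  Hence the inverse of a word
    maps U into g_i(U), where i is its last letter, and a map determines the
    last letter of any word representing it.  Cancelling last letters leaves
    either two empty words or a nonempty word acting as the identity, which is
    impossible because nonempty words are strictly expanding.  When n = 1 the
    interval is empty, and U is taken to be the whole line. *)

Lemma word_comp_cat (T : Type) (r : nat) (f : 'I_r -> T -> T) (u v : seq 'I_r) x :
  word_comp f (u ++ v) x = word_comp f u (word_comp f v x).
Proof. by elim: u => //= i u ->. Qed.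

Lemma word_comp_map (T : Type) (r r' : nat) (f : 'I_r -> T -> T)
    (h : 'I_r' -> 'I_r) (w : seq 'I_r') :
  word_comp f (map h w) = word_comp (f \o h) w.
Proof. by elim: w => //= i w ->. Qed.

(** Every word is the image under [sigma] of a word, so a relation between the [f i] is a relation
    between the relabelled maps. *)
Lemma free_semigroup_basis_perm (T : Type) (r : nat) (f : 'I_r -> T -> T)
    (sigma : 'S_r) :
  free_semigroup_basis (f \o sigma) -> free_semigroup_basis f.
Proof.
move=> free_fs u v u_n0 v_n0 eq_uv.
have mapK w : map sigma (map (sigma^-1)%g w) = w by apply: mapK; apply: permKV.
rewrite -(mapK u) -(mapK v) in eq_uv *.
congr map; apply: free_fs; [by case: u u_n0 {eq_uv} | by case: v v_n0 {eq_uv} |].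
by move: eq_uv; rewrite !word_comp_map.
Qed.

Section PingPong.

Variables (T : Type) (r : nat) (f : 'I_r -> T -> T) (U : T -> Prop).
Hypothesis f_inj : forall i, injective (f i).
Hypothesis f_surj : forall i x, exists y, f i y = x.
Hypothesis f_preim : forall i x, U (f i x) -> U x.
Hypothesis f_disj : forall i j x, U (f i x) -> U (f j x) -> i = j.

Lemma word_comp_inj w : injective (word_comp f w).
Proof. by elim: w => [x y //|i w IHw x y /f_inj /IHw]. Qed.

Lemma word_comp_preim w p : U p -> exists2 x, U x & word_comp f w x = p.
Proof.
elim: w p => [|i w IHw] p Up; first by exists p.
have [y fy] := f_surj i p.
have [|x Ux wx] := IHw y; first by apply: (f_preim (i := i)); rewrite fy.
by exists x => //=; rewrite wx.
Qed.

(** Pull [p] back along both words. Injectivity of the common map makes the two preimages equal, and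
    the last letters [i] and [j] both send this point into [U]. *)
Lemma last_letter_unique p u v i j : U p ->
  word_comp f (rcons u i) =1 word_comp f (rcons v j) -> i = j.
Proof.
move=> Up eq_uv.
have [x Ux ux] := word_comp_preim u Up; have [x' fx'] := f_surj i x.
have [y Uy vy] := word_comp_preim v Up; have [y' fy'] := f_surj j y.
have eq_xy : x' = y'.
  apply: (@word_comp_inj (rcons u i)); rewrite [RHS]eq_uv.
  by rewrite -!cats1 !word_comp_cat /= fx' fy' ux vy.
by apply: (f_disj (x := x')); rewrite ?fx' // eq_xy fy'.
Qed.

Lemma ping_pong_free p : U p ->
  (forall w, w <> [::] -> ~ word_comp f w =1 id) -> free_semigroup_basis f.
Proof.
(* Nonemptiness is dropped because cancelling last letters may leave an empty word. *)
move=> Up w_id u v _ _.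
elim/last_ind: u v => [|u i IHu] v; case/lastP: v => [|v j] //= eq_uv.
- by case: (@w_id (rcons v j)) => [|x]; [case: (v) | rewrite -eq_uv].
- by case: (@w_id (rcons u i)) => [|x]; [case: (u) | rewrite eq_uv].
have ij := last_letter_unique Up eq_uv; rewrite -ij in eq_uv *.
congr rcons; apply: IHu => x; have [y <-] := f_surj i x.
by have := eq_uv y; rewrite -!cats1 !word_comp_cat.
Qed.

End PingPong.

Section Expanding.

Variables (R : realType) (r : nat) (a b : 'I_r -> R).
Hypothesis a_gt1 : forall i, 1 < a i.

Let f i := affine (a i) (b i).
Let g i x := (x - b i) / a i.

Lemma affine_expanding i x y : x < y -> y - x < f i y - f i x.
Proof.
move=> xy; have : 0 < (a i - 1) * (y - x) by rewrite mulr_gt0 ?subr_gt0.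
by rewrite /f /affine; lra.
Qed.

(** The inequality is weak so as to cover the empty word. *)
Lemma word_comp_affine_expanding w x y :
  x < y -> y - x <= word_comp f w y - word_comp f w x.
Proof.
move=> xy; elim: w => [//|i w IHw] /=.
have /(affine_expanding i) : word_comp f w x < word_comp f w y by lra.
lra.
Qed.

Lemma word_comp_affine_neq_id w : w <> [::] -> ~ word_comp f w =1 id.
Proof.
case: w => // i w _ w_id.
(* The tail [w] keeps 0 and 1 at distance at least 1, and the head [i] then strictly increases this
   distance. *)
have := word_comp_affine_expanding w (@ltr01 R).
have := w_id 0; have := w_id 1 => /= w1 w0 le_w.
have /(affine_expanding i) : word_comp f w 0 < word_comp f w 1 by lra.
lra.
Qed.

Lemma affine_inj i : injective (f i).
Proof.
have a_neq0 : a i != 0 by have := a_gt1 i; lra.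
by move=> x y /addIr /(mulfI a_neq0).
Qed.

Lemma affineK i : cancel (f i) (g i).
Proof.
by move=> x; rewrite /g /f /affine addrK mulrC mulKf //; have := a_gt1 i; lra.
Qed.

Lemma affineVK i : cancel (g i) (f i).
Proof.
by move=> x; rewrite /g /f /affine mulrC divfK ?subrK //; have := a_gt1 i; lra.
Qed.

Lemma affine_fixE i : b i = affine_fix (a i) (b i) * (1 - a i).
Proof. by rewrite /affine_fix divfK //; have := a_gt1 i; lra. Qed.

Lemma affineV_lt i x y : x < y -> g i x < g i y.
Proof.
by move=> xy; rewrite ltr_pM2r ?ltrD2r // invr_gt0; have := a_gt1 i; lra.
Qed.

(** With s the fixed point, f x - lo = a (x - lo) - (a - 1) (s - lo), which is at most 0 if x <= lo;
    the bound [hi] is symmetric. *)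
Lemma affine_preim_itv lo hi i x : lo <= affine_fix (a i) (b i) <= hi ->
  lo < f i x < hi -> lo < x < hi.
Proof.
rewrite /f /affine; have := affine_fixE i; have := a_gt1 i.
move: (affine_fix _ _) => s a1 bE /andP[los shi] /andP[lof fhi].
rewrite !ltNge; apply/andP; split; apply/negP => xlo.
- have : 0 <= (a i - 1) * (s - lo) by rewrite mulr_ge0; lra.
  have : 0 <= a i * (lo - x) by rewrite mulr_ge0; lra.
  lra.
- have : 0 <= (a i - 1) * (hi - s) by rewrite mulr_ge0; lra.
  have : 0 <= a i * (x - hi) by rewrite mulr_ge0; lra.
  lra.
Qed.

End Expanding.

Lemma suitably_labelled_free (R : realType) (m : nat) (a b : 'I_m.+1 -> R) :
  (forall i, 1 < a i) -> suitably_labelled a b ->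
  free_semigroup_basis (fun i => affine (a i) (b i)).
Proof.
move=> a_gt1 [s_lt gap].
pose s i := affine_fix (a i) (b i); rewrite -!/(s _) in s_lt gap.
have f_surj i x : exists y, affine (a i) (b i) y = x.
  by exists ((x - b i) / a i); apply: affineVK.
have s_le (i j : 'I_m.+1) : (i <= j)%N -> s i <= s j.
  by rewrite leq_eqVlt => /orP[/eqP/val_inj-> //|/s_lt/ltW].
have w_id := word_comp_affine_neq_id (b := b) a_gt1.
case: (posnP m) => [m0|m_gt0].
  apply: (@ping_pong_free _ _ _ (fun=> True)) w_id => //; first exact: affine_inj.
  - have ord_eq0 (k : 'I_m.+1) : nat_of_ord k = 0%N.
      by apply/eqP; rewrite -leqn0 -[X in (_ <= X)%N]m0 -ltnS ltn_ord.
    by move=> i j _ _ _; apply: val_inj; rewrite /= !ord_eq0.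
  - exact: 0.
have lt_s : s ord0 < s ord_max by apply: s_lt.
have gap_lt (i j : 'I_m.+1) : (i < j)%N ->
    (s ord_max - b i) / a i <= (s ord0 - b j) / a j.
  case: j => j; elim: j => // j IHj jm; rewrite /= ltnS leq_eqVlt.
  case/orP => [/eqP ij|ij]; first by apply: gap; rewrite /= ij.
  (* Chain the gaps between neighbours: g_i(s_n) <= g_j(s_1) < g_j(s_n) <= g_{j+1}(s_1). *)
  apply: (le_trans (IHj (ltnW jm) ij)).
  apply: (le_trans (ltW (affineV_lt b a_gt1 _ lt_s))).
  exact: gap.
have disj (i j : 'I_m.+1) x : (i < j)%N ->
    s ord0 < affine (a i) (b i) x < s ord_max ->
    s ord0 < affine (a j) (b j) x < s ord_max -> False.
  (* Applying the inverses would give x < g_i(s_n) <= g_j(s_1) < x. *)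
  move=> ij /andP[_ fi] /andP[fj _].
  have := affineV_lt b a_gt1 i fi; have := affineV_lt b a_gt1 j fj.
  by rewrite !(affineK b a_gt1); have := gap_lt i j ij; lra.
(* The midpoint serves only as some point of the open interval. *)
apply: (@ping_pong_free _ _ _ (fun x => s ord0 < x < s ord_max)
          _ _ _ _ ((s ord0 + s ord_max) / 2)) w_id => //.
- exact: affine_inj.
- move=> i x; apply: affine_preim_itv => //.
  by rewrite (s_le ord0) ?(s_le _ ord_max) // -ltnS.
- move=> i j x fi fj; apply/val_inj; case: (ltngtP i j) => // ij.
  + by case: (disj i j x).
  + by case: (disj j i x).
- by apply/andP; split; lra.
Qed.

Theorem theorem1 (R : realType) (m : nat) (a b : 'I_m.+1 -> R)
  (a_gt1 : forall i, 1 < a i)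
  (relabelled : exists sigma : 'S_m.+1,
     suitably_labelled (fun i => a (sigma i)) (fun i => b (sigma i))) :
  free_semigroup_basis (fun i => affine (a i) (b i)).
Proof.
have [sigma labelled] := relabelled.
apply: (@free_semigroup_basis_perm _ _ _ sigma).
by apply: suitably_labelled_free labelled => i; apply: a_gt1.
Qed.
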